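(* Let $\mathbf s$ be a nonempty finite sequence of positive integers. Then $T(\mathbf s)$ equals the number of paths from $\mathbf s$ to $(1)$ in the Hasse diagram of $\mathcal L(\mathbf s)$, i.e. the number of sequences $\mathbf s=\mathbf s^{(0)}\lessdot\mathbf s^{(1)}\lessdot\cdots\lessdot\mathbf s^{(m)}=(1)$.
   Context: A noncommutative crossing partition of $[n]=\{1,\dots,n\}$ is a finite sequence $\pi=(\pi_1,\dots,\pi_l)$ of nonempty blocks such that each $p\in[n]$ appears exactly once in $\pi$, each block is written as an increasing sequence, and $\max(\pi_i)>\min(\pi_{i+1})$ for $1\le i\le l-1$. It is of type $(s_1,\dots,s_l)$ if $\pi_i$ has $s_i$ elements for each $i$. For $\mathbf s=(s_1,\dots,s_l)$ a sequence of positive integers with sum $n$, $T(\mathbf s)$ is the number of noncommutative crossing partitions of $[n]$ of type $\mathbf s$. Define $$S_1(\mathbf s)=\{i\le l-1: s_i>1\}\cup\{l\},\qquad S_2(\mathbf s)=\{i\le l-1: s_{i+1}\ge2\}.$$ For finite nonempty sequences of positive integers, $\mathbf s\lessdot\mathbf s'$ means that either $\mathbf s'=(s_1,\dots,s_{i-1},s_i-1,s_{i+1},\dots,s_l)$ for some $i\in S_1(\mathbf s)$ (where for $i=l$ and $s_l=1$ the last entry $0$ is deleted, so $\mathbf s'=(s_1,\dots,s_{l-1})$), or $\mathbf s'=(s_1,\dots,s_{i-1},s_i+s_{i+1}-1,s_{i+2},\dots,s_l)$ for some $i\in S_2(\mathbf s)$. $\mathcal L(\mathbf s)$ is the poset generated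 by these cover relations starting from the minimum element $\mathbf s$; its greatest element is $(1)$. *)

(* Defs.v *)
From mathcomp Require Import all_boot.
Set Implicit Arguments.
Unset Strict Implicit.
Unset Printing Implicit Defensive.

(* [n] = {1, ..., n} is represented by 'I_n, the ordinal p standing for p + 1;
   positions in a sequence are numbered from 0 accordingly.  A block, being
   written in increasing order, is the same thing as a set. *)

Definition block_max n (A : {set 'I_n}) : nat := \max_(p in A) p.

(* The default value n exceeds every element, so this is the minimum as soon as
   A is nonempty. *)
Definition block_min n (A : {set 'I_n}) : nat := \big[minn/n]_(p in A) p.

Definition is_ncp n (pi : seq {set 'I_n}) : bool :=
  [&& set0 \notin pi,
      [forall p : 'I_n, count (fun A : {set 'I_n} => p \in A) pi == 1]
    & sorted (fun A B => block_max A > block_min B) pi].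

Definition ncp_type n (pi : seq {set 'I_n}) : seq nat :=
  [seq #|A| | A : {set 'I_n} <- pi].

Definition T (s : seq nat) : nat :=
  #|[set pi : (size s).-tuple {set 'I_(sumn s)} |
      is_ncp pi && (ncp_type pi == s)]|.

Definition S1 (s : seq nat) : {set 'I_(size s)} :=
  [set i : 'I_(size s) |
    (i.+1 < size s) && (nth 0 s i > 1) || (i.+1 == size s)].

Definition S2 (s : seq nat) : {set 'I_(size s)} :=
  [set i : 'I_(size s) | (i.+1 < size s) && (nth 0 s i.+1 >= 2)].

(* For i in S1 s the entry being decremented can be 1 only if it is the last. *)
Definition decr_entry (s : seq nat) (i : nat) : seq nat :=
  take i s ++ (if nth 0 s i == 1 then [::] else [:: nth 0 s i - 1])
           ++ drop i.+1 s.

Definition merge_entries (s : seq nat) (i : nat) : seq nat :=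
  take i s ++ (nth 0 s i + nth 0 s i.+1 - 1) :: drop i.+2 s.

Definition lessdot : rel (seq nat) := fun s s' =>
  [&& s != [::], s' != [::] &
      [exists i in S1 s, s' == decr_entry s i]
   || [exists i in S2 s, s' == merge_entries s i]].

(* p lists s^(1), ..., s^(m); the starting point s^(0) = s is left out. *)
Definition hasse_path (s : seq nat) (p : seq (seq nat)) : bool :=
  path lessdot s p && (last s p == [:: 1]).

Definition has_card (X : eqType) (P : pred X) (N : nat) : Prop :=
  exists e : seq X, [/\ uniq e, forall x, (x \in e) = P x & size e = N].

(* Main.v *)
Require Import Defs.
From mathcomp Require Import all_boot.
From mathcomp Require Import zify.

Set Implicit Arguments.
Unset Strict Implicit.
Unset Printing Implicit Defensive.

(* Encode a noncommutative crossing partition by the word listing, for each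
   p in [n], the index of its block.  Removing the first letter a, i.e. the
   element 1 from its block, leaves a word for the decremented type, unless block
   a now lies entirely after block a - 1; in that case fusing these two blocks
   gives a word for the merged type, from which the original is recovered since
   the sizes are known.  Hence T satisfies the same recursion over the covers of
   s as the number of paths to (1). *)

(** * Cardinalities by enumeration, and sums over disjoint images *)

Lemma has_card_uniq (X : eqType) (P : pred X) M N :
  has_card P M -> has_card P N -> M = N.
Proof.
move=> [e1 [u1 m1 <-]] [e2 [u2 m2 <-]].
by apply/perm_size/uniq_perm => // x; rewrite m1 m2.
Qed.

(** Joint injectivity of [F] in the index and the element makes the images disjoint, so their
    enumerations can be concatenated. Words and paths are both counted this way over the same list
    of steps, which gives them the same recursion. *)
Lemma has_card_bigcup (I X Y : eqType) (r : seq I) (P : I -> pred X)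
    (Q : pred Y) (N : I -> nat) (F : I -> X -> Y) :
  uniq r -> (forall i, i \in r -> has_card (P i) (N i)) ->
  (forall i j x y, i \in r -> j \in r -> P i x -> P j y ->
     F i x = F j y -> i = j /\ x = y) ->
  (forall y, Q y <-> exists i x, [/\ i \in r, P i x & y = F i x]) ->
  has_card Q (\sum_(i <- r) N i).
Proof.
elim: r Q => [|i r IH] Q /=.
  move=> _ _ _ QP; exists [::]; split; rewrite ?big_nil // => y.
  by rewrite in_nil; apply/esym/negP => /QP [j [x []]].
case/andP=> ir ur cP inj QP.
have [e [ue me se]] := cP i (mem_head _ _).
(* The induction hypothesis is applied to the part of [Q] outside the image coming from the index
   [i]. *)
have [|||e' [ue' me' se']] :=
    IH (fun y => Q y && (y \notin map (F i) e)) ur.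
- by move=> j jr; apply: cP; rewrite inE jr orbT.
- by move=> j k x y jr kr; apply: inj; rewrite inE ?jr ?kr orbT.
- move=> y; split.
    case/andP=> /QP [j [x [+ Pjx ->]]] ny; rewrite inE => /orP [/eqP ji|jr].
      by case/negP: ny; rewrite ji map_f // me -ji.
    by exists j, x.
  case=> j [x [jr Pjx ->]]; apply/andP; split.
    by apply/QP; exists j, x; rewrite inE jr orbT.
  apply/mapP => -[z]; rewrite me => Piz E.
  have [] := inj j i x z _ _ Pjx Piz E; rewrite ?inE ?jr ?eqxx ?orbT // => ji.
  by rewrite -ji jr in ir.
exists (map (F i) e ++ e'); split.
- rewrite cat_uniq ue' andbT map_inj_in_uniq ?ue /=; last first.
    move=> x y; rewrite !me => Px Py E.
    by have [] := inj i i x y _ _ Px Py E; rewrite ?mem_head.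
  by apply/hasPn => y; rewrite me' => /andP [].
- move=> y; rewrite mem_cat me'; case: (boolP (y \in _)) => /=; rewrite ?andbT //.
  case/mapP=> x; rewrite me => Px ->; apply/esym/QP.
  by exists i, x; rewrite mem_head.
- by rewrite size_cat size_map se se' big_cons.
Qed.

(** * Words: ordered pairs of letters, letter counts and the crossing condition *)

Lemma subseq2_cons (a b x : nat) w :
  subseq [:: a; b] (x :: w) = if x == a then b \in w else subseq [:: a; b] w.
Proof. by rewrite [LHS]/= eq_sym; case: eqP; rewrite ?sub1seq. Qed.

Lemma subseq2P (a b : nat) w :
  reflect (exists p q, [/\ p < q, q < size w, nth 0 w p = a & nth 0 w q = b])
          (subseq [:: a; b] w).
Proof.
elim: w => [|x w IH]; first by right=> -[p [q []]].
rewrite subseq2_cons; case: eqVneq => [->|xa].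
  apply: (iffP (nthP 0)) => [[q qw <-]|[p [[|q] [pq qw _ <-]]]] //.
    by exists 0, q.+1.
  by exists q.
apply: (iffP IH) => -[p [q [pq qw pa qb]]].
  by exists p.+1, q.+1.
case: p q pq qw pa qb => [|p] [|q] //= pq qw pa qb.
  by rewrite pa eqxx in xa.
by exists p, q.
Qed.

Definition occ (j : nat) (w : seq nat) : nat := count_mem j w.
Arguments occ : simpl never.

Lemma occ_cons j x w : occ j (x :: w) = (x == j) + occ j w.
Proof. by []. Qed.

Lemma occ_gt0 j w : (0 < occ j w) = (j \in w).
Proof. by rewrite /occ -has_count has_pred1. Qed.

Lemma occ_eq0 j w : (occ j w == 0) = (j \notin w).
Proof. by rewrite -occ_gt0 -leqn0 -ltnNge ltnS. Qed.

(* The word has the index of the block containing p as its p-th letter;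
   [max(pi_i) > min(pi_(i+1))] says that some letter [i+1] precedes some
   letter [i]. *)
Definition crossing_word (s w : seq nat) : bool :=
  [&& [seq occ i w | i <- iota 0 (size s)] == s,
      all (gtn (size s)) w
    & all (fun i => subseq [:: i.+1; i] w) (iota 0 (size s).-1)].

(** Since [nth] returns 0 beyond the end of [s], prescribing the count of every letter also bounds
    the letters by [size s]. *)
Lemma crossing_wordP s w :
  reflect ((forall i, occ i w = nth 0 s i) /\
           (forall i, i.+1 < size s -> subseq [:: i.+1; i] w))
          (crossing_word s w).
Proof.
apply: (iffP and3P) => [[/eqP cs lw cr]|[cw cr]]; split.
- move=> i; case: (ltnP i (size s)) => si.
    by rewrite -[in RHS]cs (nth_map 0) ?size_iota // nth_iota.
  rewrite nth_default //; apply/eqP; rewrite occ_eq0; apply/negP => /(allP lw) /=.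
  by rewrite ltnNge si.
- by move=> i si; apply: (allP cr); rewrite mem_iota; lia.
- apply/eqP/(@eq_from_nth _ 0); first by rewrite size_map size_iota.
  move=> i; rewrite size_map size_iota => si.
  by rewrite (nth_map 0) ?size_iota // nth_iota.
- apply/allP => x xw /=; rewrite ltnNge; apply/negP => sx.
  by move/eqP: (cw x); rewrite nth_default // occ_eq0 xw.
- by apply/allP => i; rewrite mem_iota => si; apply: cr; lia.
Qed.

(** * Fusing and splitting two consecutive blocks *)

(* Undoes the fusion of blocks i and i+1: the first k letters i are kept, the
   later ones become i+1. *)
Fixpoint split_word (i k : nat) (v : seq nat) : seq nat :=
  match v with
  | [::] => [::]
  | x :: v' =>
    if x < i then x :: split_word i k v'
    else if x == i then
      (if k is k'.+1 then i :: split_word i k' v' else i.+1 :: split_word i 0 v')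
    else x.+1 :: split_word i k v'
  end.

Definition merge_letter (i x : nat) : nat := if x <= i then x else x.-1.

Lemma split_wordK i k : cancel (split_word i k) (map (merge_letter i)).
Proof.
move=> v; elim: v k => //= x v IH k.
by case: ltngtP => [xi|xi|->]; [idtac|idtac|case: k] => /= *; rewrite IH /merge_letter;
  congr (_ :: _); case: leqP; lia.
Qed.

(** When no [i.+1] precedes an [i], every [i] comes before every [i.+1], so the number of letters
    [i] alone tells where to cut the fused block. *)
Lemma merge_wordK i w : ~~ subseq [:: i.+1; i] w ->
  split_word i (occ i w) (map (merge_letter i) w) = w.
Proof.
elim: w => // x w IH; rewrite subseq2_cons occ_cons [map _ _]/=.
case: (eqVneq x i.+1) => [->|xi] iw.
  have nc : ~~ subseq [:: i.+1; i] w.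
    by apply: contra iw => /mem_subseq; apply; rewrite !inE eqxx orbT.
  have := IH nc; move: iw; rewrite -occ_eq0 => /eqP -> /= E.
  rewrite /merge_letter ltnn /= ltnn eqxx -[in RHS]E.
  by case: eqP => //; lia.
have mx : merge_letter i x = if x <= i then x else x.-1 by [].
rewrite {}mx [split_word _ _ _]/=; case: (ltngtP x i) => xi'.
- by rewrite xi' IH.
- do 2 (rewrite ifN; last by lia).
  by rewrite (ltn_predK xi'); congr (_ :: _); exact: IH.
- by rewrite xi' ltnn eqxx; congr (_ :: _); exact: IH.
Qed.

Lemma split_word_noncrossing i k v : ~~ subseq [:: i.+1; i] (split_word i k v).
Proof.
(* Once the counter has run out, no further [i] is produced; before that, no [i.+1] is. *)
have H0 u : i \notin split_word i 0 u.
  by elim: u => //= x u IH; case: ltngtP => xi; rewrite inE negb_or IH andbT; lia.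
elim: v k => // x v IH k; rewrite [split_word _ _ _]/=.
case: ltngtP => xi; [idtac|idtac|case: k => [|k]];
  rewrite subseq2_cons; case: eqP => //; lia.
Qed.

Lemma count_merge i w j : occ j (map (merge_letter i) w) =
  if j < i then occ j w
  else if j == i then occ i w + occ i.+1 w
  else occ j.+1 w.
Proof.
elim: w => [|x w IH] /=; first by case: ltngtP.
rewrite !occ_cons IH /merge_letter; case: ltngtP => ji; case: leqP => xi; lia.
Qed.

Lemma count_split i k v j : occ j (split_word i k v) =
  if j < i then occ j v
  else if j == i then minn k (occ i v)
  else if j == i.+1 then occ i v - k
  else occ j.-1 v.
Proof.
elim: v k => [|x v IH] k /=; first by rewrite /occ /= minn0 sub0n !if_same.
rewrite !occ_cons.
have [xi|xi] := ltnP x i; last have [xi'|xi'] := eqVneq x i.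
- by rewrite occ_cons IH; do ?case: ifP => //; lia.
- by case: k => [|k]; rewrite occ_cons IH; do ?case: ifP => //; lia.
- by rewrite occ_cons IH; do ?case: ifP => //; lia.
Qed.

Lemma mem_split i k v j : j != i -> j != i.+1 ->
  (j \in split_word i k v) = ((if j < i then j else j.-1) \in v).
Proof.
move=> ji ji1; rewrite -!occ_gt0 count_split (negbTE ji) (negbTE ji1).
by case: ifP.
Qed.

Lemma mem_split1 i k v : (i.+1 \in split_word i k v) = (k < occ i v).
Proof. by rewrite -occ_gt0 count_split; do ?case: ifP => //; lia. Qed.

(** The conditional is the letter that [j] had before splitting. A crossing that involves the fused
    letter survives through an extremal occurrence: the first fused letter stays [i] if [0 < k], and
    the last one becomes [i.+1] if [k < occ i v]. *)
Lemma split_crossing i k v j : j != i ->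
  (j.+1 = i -> 0 < k) -> (j = i.+1 -> k < occ i v) ->
  subseq [:: (if j < i then j else j.-1).+1; if j < i then j else j.-1] v ->
  subseq [:: j.+1; j] (split_word i k v).
Proof.
move=> ji; elim: v k => // x v IH k k0 k1.
rewrite subseq2_cons [split_word _ _ _]/=.
case: (ltngtP x i) => xi.
- rewrite subseq2_cons; case: (ltngtP j i) ji => // ji _.
    case: eqP => xj; first by rewrite mem_split ?ji //; lia.
    by move=> H; apply: IH => //; [lia|move: H; rewrite ji].
  do 2 (rewrite ifN; last by lia).
  move=> H; apply: IH => //; last by rewrite ltnNge ltnW.
  by move=> /k1; rewrite occ_cons; lia.
- rewrite subseq2_cons; case: (ltngtP j i) ji => // ji _.
    do 2 (rewrite ifN; last by lia).
    by move=> H; apply: IH => //; [lia|rewrite ji].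
  have -> : (x.+1 == j.+1) = (x == j.-1.+1) by lia.
  case: eqP => xj H.
    have [ji1|ji1] := eqVneq j i.+1.
      by rewrite ji1 mem_split1; move: (k1 ji1); rewrite occ_cons; lia.
    by rewrite mem_split ?ji1 //; [rewrite ltnNge ltnW | lia].
  apply: IH => //; last by rewrite ltnNge ltnW.
  by move=> /k1; rewrite occ_cons; lia.
- subst x; case: k k0 k1 => [|k] k0 k1; rewrite subseq2_cons.
    case: (ltngtP j i) ji => // ji _.
      do 2 (rewrite ifN; last by lia).
      by move=> H; apply: IH => //; [lia|rewrite ji].
    do 2 (rewrite ifN; last by lia).
    move=> H; apply: IH => //; last by rewrite ltnNge ltnW.
    move=> j1; rewrite occ_gt0; move: H; rewrite j1 /=.
    by move/mem_subseq; apply; rewrite !inE eqxx orbT.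
  case: (ltngtP j i) ji => // ji _.
    case: eqP => ij; first by rewrite mem_split ?ji //; lia.
    by move=> H; apply: IH => //; [lia..|rewrite ji].
  do 2 (rewrite ifN; last by lia).
  move=> H; apply: IH => //; last by rewrite ltnNge ltnW.
  - by lia.
  - by move=> /k1; rewrite occ_cons eqxx.
Qed.

(** * Covers of [s] indexed by steps *)

(* (i, false) stands for decrementing entry i, (i, true) for merging entries i
   and i+1. *)
Definition is_step (s : seq nat) (x : nat * bool) : bool :=
  if x.2 then (x.1.+1 < size s) && (1 < nth 0 s x.1.+1)
  else (x.1.+1 < size s) && (1 < nth 0 s x.1) || (x.1.+1 == size s).

Definition step_seq (s : seq nat) (x : nat * bool) : seq nat :=
  if x.2 then merge_entries s x.1 else decr_entry s x.1.

(** Puts the removed first letter back. In the merge case this letter is [x.1.+1], and [nth 0 s x.1]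
    is the number of letters of the fused block that belong to the first of the two blocks. *)
Definition step_word (s : seq nat) (x : nat * bool) (v : seq nat) : seq nat :=
  if x.2 then x.1.+1 :: split_word x.1 (nth 0 s x.1) v else x.1 :: v.

Definition steps (s : seq nat) : seq (nat * bool) :=
  [seq x <- [seq (i, b) | i <- iota 0 (size s), b <- [:: false; true]]
  | is_step s x].

Lemma uniq_steps s : uniq (steps s).
Proof.
by apply/filter_uniq/allpairs_uniq => //; [exact: iota_uniq | case=> ? ? [? ?] _ _].
Qed.

Lemma mem_steps s x : (x \in steps s) = is_step s x.
Proof.
rewrite mem_filter andb_idr //; case: x => i b H.
apply/allpairsPdep; exists i, b; rewrite mem_iota; move: H; rewrite /is_step /= => H.
by split; [case: b H; lia | case: (b) |].
Qed.

Lemma positive_nth s i : all (fun k => 0 < k) s -> i < size s -> 0 < nth 0 s i.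
Proof. by move=> /(all_nthP 0); apply. Qed.

Lemma size_decr s i : i < size s ->
  size (decr_entry s i) = size s - (nth 0 s i == 1).
Proof.
by move=> si; rewrite !size_cat size_take size_drop si; case: eqP => /=; lia.
Qed.

(** Deleting a last entry 1 looks like lowering it to 0, because [nth] returns 0 past the end; hence
    one formula covers both cases. *)
Lemma nth_decr s i j : is_step s (i, false) ->
  nth 0 (decr_entry s i) j = nth 0 s j - (j == i).
Proof.
rewrite /is_step /= => si; rewrite !nth_cat size_take.
have -> : i < size s by lia.
case: (ltngtP j i) => ji.
- by rewrite nth_take // subn0.
- have [s1|s1] := eqVneq (nth 0 s i) 1.
    rewrite !nth_default //= ?size_drop; lia.
  rewrite nth_drop subn0 /=.
  by rewrite ifN; [congr (nth _ _ _)|]; lia.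
- rewrite ji subnn; case: eqP => [s1|_] //=.
  by rewrite drop_oversize ?s1 //; lia.
Qed.

Lemma size_merge s i : i.+1 < size s -> size (merge_entries s i) = (size s).-1.
Proof. by move=> si; rewrite size_cat /= size_take size_drop (ltnW si); lia. Qed.

Lemma nth_merge s i j : i.+1 < size s ->
  nth 0 (merge_entries s i) j =
  if j < i then nth 0 s j
  else if j == i then nth 0 s i + nth 0 s i.+1 - 1 else nth 0 s j.+1.
Proof.
move=> si; rewrite nth_cat size_take (ltnW si).
case: (ltngtP j i) => ji; first by rewrite nth_take.
  have -> : j - i = (j - i).-1.+1 by lia.
  by rewrite /= nth_drop; congr (nth _ _ _); lia.
by rewrite ji subnn.
Qed.

Lemma step_seq_positive s x : all (fun k => 0 < k) s -> is_step s x ->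
  all (fun k => 0 < k) (step_seq s x).
Proof.
case: x => i [] sp si; apply/(all_nthP 0) => j; rewrite /step_seq /=.
  case/andP: si => /= si s1; rewrite size_merge // => js; rewrite nth_merge //.
  case: ifP => _; first by apply: positive_nth => //; lia.
  by case: ifP => _; [lia | apply: positive_nth => //; lia].
have is_ : i < size s by move: si; rewrite /is_step /=; lia.
rewrite size_decr // nth_decr // => js; have [ji|ji] := eqVneq j i.
  subst j; have := positive_nth sp is_; move: js si; rewrite /is_step /=.
  by case: eqP; lia.
by rewrite subn0 positive_nth //; lia.
Qed.

Lemma step_seq_neq0 s x : all (fun k => 0 < k) s -> s != [:: 1] ->
  is_step s x -> step_seq s x != [::].
Proof.
case: x => i [] sp s1 si; rewrite -size_eq0 /step_seq /=.
  by case/andP: si => /= si _; rewrite size_merge //; lia.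
have is_ : i < size s by move: si; rewrite /is_step /=; lia.
rewrite size_decr //; case: s {si} s1 sp is_ => [|a [|b s]] //=; last by lia.
by case: i => // s1 _ _ /=; case: (a =P 1) s1 => // ->.
Qed.

Lemma sumn_step_seq s x : all (fun k => 0 < k) s -> is_step s x ->
  sumn s = (sumn (step_seq s x)).+1.
Proof.
case: x => i b sp si.
have is_ : i < size s by move: si; rewrite /is_step /=; case: b; lia.
have := positive_nth sp is_.
rewrite -[in LHS](cat_take_drop i s) (drop_nth 0) //.
case: b si => si; rewrite /step_seq /=; last first.
  by rewrite !sumn_cat /=; case: eqP => [->|] /=; lia.
case/andP: si => /= si _; have := positive_nth sp si.
by rewrite !sumn_cat [drop i.+1 _](drop_nth 0) //=; lia.
Qed.

(** A merge strictly raises the entry at its index, since the next entry is at least 2, and leaves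
    the earlier entries alone; a decrement lowers its own entry and changes no other. Comparing the
    entries at both indices separates distinct steps, so counting covers amounts to counting
    steps. *)
Lemma step_seq_inj s : all (fun k => 0 < k) s ->
  {in is_step s &, injective (step_seq s)}.
Proof.
move=> sp [i b] [j c]; rewrite -!topredE /= => si sj /esym E.
have H k : nth 0 (step_seq s (i, b)) k = nth 0 (step_seq s (j, c)) k by rewrite E.
have Hs : size (step_seq s (i, b)) = size (step_seq s (j, c)) by rewrite E.
have is_ : i < size s by move: si; rewrite /is_step /=; case: (b); lia.
have js_ : j < size s by move: sj; rewrite /is_step /=; case: (c); lia.
have := positive_nth sp is_; have := positive_nth sp js_.
have := H i; have := H j; move: si sj Hs; rewrite /step_seq /=.
case: b {E H} => si; case: c => sj; rewrite ?nth_decr ?size_decr //.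
- move: si sj; rewrite /is_step /= => /andP [si s1] /andP [sj s1'].
  rewrite !nth_merge // ?ltnn ?eqxx => _.
  by case: (ltngtP i j) => [||->] //; lia.
- move: si => /andP [/= si s1]; rewrite !nth_merge // !size_merge // => _ _.
  by rewrite ltnn eqxx; lia.
- move: sj => /andP [/= sj s1]; rewrite !nth_merge // !size_merge // => _.
  by rewrite ltnn eqxx; lia.
- by move=> _; have [-> | ] := eqVneq i j => //; rewrite ?eqxx; lia.
Qed.

(** Only from [[:: 1]] could a step reach the empty sequence, which [lessdot] excludes. *)
Lemma lessdotP s t : s != [::] -> all (fun k => 0 < k) s -> s != [:: 1] ->
  reflect (exists2 x, x \in steps s & t = step_seq s x) (lessdot s t).
Proof.
move=> s0 sp s1; rewrite /lessdot s0 /=; apply: (iffP andP).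
  case=> _ /orP [] /exists_inP [i]; rewrite inE => si /eqP ->.
    by exists (i : nat, false); rewrite ?mem_steps.
  by exists (i : nat, true); rewrite ?mem_steps.
case=> [[i b]]; rewrite mem_steps => si ->; split; first exact: step_seq_neq0.
have is_ : i < size s by move: si; rewrite /is_step /=; case: (b); lia.
apply/orP; case: b si => si; [right|left]; apply/exists_inP;
  by exists (Ordinal is_); rewrite ?inE //=.
Qed.

(** * Removing and restoring the first letter of a crossing word *)

Lemma subseq_behead (a b x : nat) w :
  subseq [:: a; b] w -> subseq [:: a; b] (x :: w).
Proof. by move/subseq_trans; apply; exact: subseq_cons. Qed.

Lemma crossing_cons s i v : all (fun k => 0 < k) s -> is_step s (i, false) ->
  crossing_word (decr_entry s i) v -> crossing_word s (i :: v).
Proof.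
move=> sp si /crossing_wordP [cv rv]; have is_ : i < size s.
  by move: si; rewrite /is_step /=; lia.
have cw j : occ j (i :: v) = nth 0 s j.
  rewrite occ_cons cv nth_decr //; have [->|ji] := eqVneq j i.
    by have := positive_nth sp is_; lia.
  by rewrite subn0.
apply/crossing_wordP; split => // j js; rewrite size_decr // in rv.
(* The only crossing not inherited from [v] is that of the last two blocks when the last entry is 1
   and gets deleted; there the new first letter provides it. *)
have [ns|] := boolP ((nth 0 s i == 1) && (j.+2 == size s)); last first.
  move=> H; apply/subseq_behead/rv; case: eqP H => _ /=; lia.
have ij : i = j.+1 by move: si ns; rewrite /is_step /=; lia.
rewrite subseq2_cons ij eqxx -occ_gt0.
have := cw j; rewrite occ_cons ij; have := positive_nth sp (ltnW js).
lia.
Qed.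

(** Removing the first letter [i] can only destroy the crossing of blocks [i.-1] and [i]. The three
    alternatives say that there is no block [i.-1], that block [i] disappears, or that the crossing
    persists in [w]. *)
Lemma crossing_behead s i w : crossing_word s (i :: w) ->
  [|| i == 0, nth 0 s i == 1 | subseq [:: i; i.-1] w] ->
  is_step s (i, false) /\ crossing_word (decr_entry s i) w.
Proof.
move=> /crossing_wordP [cw rw] iw.
have ci := cw i; rewrite occ_cons eqxx in ci.
have is_ : i < size s by rewrite ltnNge; apply/negP => /(nth_default 0); lia.
have si : is_step s (i, false).
  rewrite /is_step /=; case: (eqVneq i.+1 (size s)) => [|si]; first by rewrite orbT.
  have si' : i.+1 < size s by lia.
  (* The crossing with the next block cannot use the first letter [i] as its [i.+1], so another [i]
     occurs in [w] and entry [i] is at least 2. *)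
  rewrite si' orbF; have := rw _ si'; rewrite subseq2_cons.
  by case: eqP => [|_ /mem_subseq/(_ i)]; [lia | rewrite !inE eqxx orbT -occ_gt0; lia].
split=> //; apply/crossing_wordP; split=> j.
  by have := cw j; rewrite occ_cons nth_decr // eq_sym; lia.
rewrite size_decr // => js; have := rw j; rewrite subseq2_cons.
case: eqP => [ij _|_]; last by apply; lia.
move: iw si js; rewrite ij /= /is_step; case/orP=> // /eqP ->; rewrite /=; lia.
Qed.

(** The fused letter occurs [nth 0 s i + nth 0 s i.+1 - 1] times: the first [nth 0 s i] occurrences
    stay [i], and the others together with the new first letter make up block [i.+1]. That first
    letter also crosses the two blocks. *)
Lemma crossing_split s i v : all (fun k => 0 < k) s -> is_step s (i, true) ->
  crossing_word (merge_entries s i) v ->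
  crossing_word s (i.+1 :: split_word i (nth 0 s i) v).
Proof.
move=> sp /andP [/= si s1] /crossing_wordP [cv rv].
have s0 := positive_nth sp (ltnW si).
have ci := cv i; rewrite nth_merge // ltnn eqxx in ci.
apply/crossing_wordP; split => j.
  rewrite occ_cons count_split ci cv nth_merge //.
  case: (ltngtP j i) => ji; [lia| |rewrite ji; lia].
  case: (eqVneq j i.+1) => [->|ji1]; first by lia.
  rewrite cv nth_merge //; do 2 (rewrite ifN; last by lia).
  by rewrite (ltn_predK ji); lia.
move=> js; have [->|ji] := eqVneq j i.
  by rewrite subseq2_cons eqxx -occ_gt0 count_split ltnn eqxx; lia.
apply/subseq_behead/split_crossing => //; first by rewrite ci; lia.
by apply: rv; rewrite size_merge //; case: ifP; lia.
Qed.

Lemma crossing_merge s i w :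
  crossing_word s (i.+1 :: w) -> ~~ subseq [:: i.+1; i] w -> nth 0 s i.+1 != 1 ->
  is_step s (i, true) /\ crossing_word (merge_entries s i) (map (merge_letter i) w).
Proof.
move=> /crossing_wordP [cw rw] iw s1.
have ci := cw i.+1; rewrite occ_cons eqxx in ci.
have si : i.+1 < size s by rewrite ltnNge; apply/negP => /(nth_default 0); lia.
split; first by rewrite /is_step /= si; lia.
apply/crossing_wordP; split => j.
  rewrite nth_merge // count_merge -!cw !occ_cons.
  by case: (ltngtP j i) => ji; lia.
rewrite size_merge // => js.
(* For [k] other than [i], the crossing pair does not use the first letter [i.+1], so it lies in [w]
   and is carried along by the letter map. Indices below [i] come from [k = j], the others from
   [k = j.+1]. *)
have sub k : k != i -> k.+1 < size s ->
    subseq [:: merge_letter i k.+1; merge_letter i k] (map (merge_letter i) w).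
  move=> ki ks; apply: (map_subseq (merge_letter i) (s1 := [:: k.+1; k])).
  by have := rw k ks; rewrite subseq2_cons eqSS eq_sym (negbTE ki).
have [ji|ji] := ltnP j i.
  by have := sub j; rewrite /merge_letter ji (ltnW ji); apply; lia.
by have := sub j.+1; rewrite /merge_letter !ltnNge ji (leqW ji) /=; apply; lia.
Qed.

Lemma crossing_word_step s w :
  s != [::] -> all (fun k => 0 < k) s -> s != [:: 1] ->
  crossing_word s w <-> exists x v,
    [/\ x \in steps s, crossing_word (step_seq s x) v & w = step_word s x v].
Proof.
move=> s0 sp s1; split=> [cw|[[i b] [v []]]]; last first.
  rewrite mem_steps => si cv ->; case: b si cv => si cv.
    exact: crossing_split.
  exact: crossing_cons.
have w0 : w != [::].
  apply: contraTneq cw => ->; apply/negP => /crossing_wordP [/(_ 0)] + _.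
  by case: s s0 sp {s1} => //= a s _ /andP [] /=; rewrite /occ /=; lia.
case: w w0 cw => // a w _ cw.
have [H|] := boolP [|| a == 0, nth 0 s a == 1 | subseq [:: a; a.-1] w].
  have [sa cv] := crossing_behead cw H.
  by exists (a, false), w; rewrite mem_steps.
case: a cw => // a cw; rewrite !negb_or => /and3P [_ s1' aw].
have [sa cv] := crossing_merge cw aw s1'.
exists (a, true), (map (merge_letter a) w); rewrite mem_steps; split=> //.
congr (_ :: _); rewrite -[LHS](merge_wordK aw); congr (split_word _ _ _).
(* The removed letter is [a.+1], so [w] still contains all letters [a], and their number is the
   cutting point [nth 0 s a]. *)
have /crossing_wordP [/(_ a) <- _] := cw.
by rewrite occ_cons; lia.
Qed.

(** The first letter fixes the index once the kind of step is known. The kinds differ in the tail: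
    after a merge step no [i.+1] precedes an [i], whereas a decrement of entry [i.+1], which is at
    least 2 here, leaves that crossing in place. *)
Lemma step_word_inj s x y u v : is_step s x -> is_step s y ->
  crossing_word (step_seq s x) u -> crossing_word (step_seq s y) v ->
  step_word s x u = step_word s y v -> x = y /\ u = v.
Proof.
have H i j u' v' : is_step s (i, true) -> is_step s (j, false) ->
    crossing_word (step_seq s (j, false)) v' ->
    step_word s (i, true) u' = step_word s (j, false) v' -> False.
  move=> /andP [/= si s1] sj /crossing_wordP [_ rv] [] ji uv.
  have /negP := split_word_noncrossing i (nth 0 s i) u'; apply; rewrite uv.
  by apply: rv; rewrite /step_seq size_decr /= -?ji //; lia.
case: x => i b; case: y => j c; case: b; case: c => sx sy cu cv E.
- by case: E => ij; rewrite ij => /(can_inj (@split_wordK _ _)) ->.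
- by case: (H _ _ _ _ sx sy cv E).
- by case: (H _ _ _ _ sy sx cu (esym E)).
- by case: E => -> ->.
Qed.

(** * The common recursion for words and paths *)

Lemma has_card1 (X : eqType) (P : pred X) a : P =1 pred1 a -> has_card P 1.
Proof. by move=> Pa; exists [:: a]; split=> // x; rewrite inE Pa. Qed.

Lemma crossing_word1 w : crossing_word [:: 1] w = (w == [:: 0]).
Proof.
apply/crossing_wordP/eqP => [[cw _]|->]; last first.
  by split=> [[|[|i]]|].
case: w cw => [/(_ 0)|a w cw] //.
have a0 : a = 0 by have := cw a; rewrite occ_cons eqxx; case: (a) => [|[|]] //=; lia.
case: w cw => [|b w cw]; rewrite ?a0 //.
have := cw b; have := cw 0; rewrite !occ_cons eqxx a0 eqxx.
by case: (b) => [|[|?]] //=; lia.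
Qed.

Lemma hasse_path1 p : hasse_path [:: 1] p = (p == [::]).
Proof.
case: p => [|t p] //; apply/negP; rewrite /hasse_path /= -andbA => /andP [+ _].
rewrite /lessdot => /and3P [_ t0 /orP [] /exists_inP [i]]; rewrite inE //= => _.
by rewrite ord1 /decr_entry /= => /eqP t1; rewrite t1 in t0.
Qed.

(** Strong induction on [sumn s], which every step lowers by 1: words and paths both decompose over
    the steps of [s], and for [[:: 1]] there is one of each. *)
Lemma has_card_hasse_path s N : s != [::] -> all (fun k => 0 < k) s ->
  has_card (crossing_word s) N -> has_card (hasse_path s) N.
Proof.
move=> s0 sp cN; suff [M cM hM] : exists2 M,
    has_card (crossing_word s) M & has_card (hasse_path s) M.
  by rewrite (has_card_uniq cN cM).
have [n] := ubnP (sumn s); elim: n s s0 sp {N cN} => // n IH s s0 sp sn.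
have [->|s1] := eqVneq s [:: 1].
  exists 1; first exact/has_card1/crossing_word1.
  exact/has_card1/hasse_path1.
have IH' x : x \in steps s -> exists2 M,
    has_card (crossing_word (step_seq s x)) M & has_card (hasse_path (step_seq s x)) M.
  rewrite mem_steps => sx; apply: IH; first exact: step_seq_neq0.
    exact: step_seq_positive.
  by move: sn; rewrite (sumn_step_seq sp sx); lia.
(* Finite choice along the list of steps turns the separate cardinalities into one function. *)
have [N HN] : exists N, {in steps s, forall x,
    has_card (crossing_word (step_seq s x)) (N x) /\
    has_card (hasse_path (step_seq s x)) (N x)}.
  elim: (steps s) IH' => [|x r IHr] H; first by exists (fun _ => 0).
  have [y yr|N HN] := IHr; first by apply: H; rewrite inE yr orbT.
  have [M cM hM] := H x (mem_head _ _).
  exists (fun y => if y == x then M else N y) => y; rewrite inE.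
  by case: eqP => [->|_] //= yr; apply: HN.
exists (\sum_(x <- steps s) N x).
- apply: (has_card_bigcup (P := fun x => crossing_word (step_seq s x))
     (F := step_word s)).
  + exact: uniq_steps.
  + by move=> x /HN [].
  + by move=> x y u v; rewrite !mem_steps; exact: step_word_inj.
  + by move=> w; exact: crossing_word_step.
- apply: (has_card_bigcup (P := fun x => hasse_path (step_seq s x))
     (F := fun x p => step_seq s x :: p)).
  + exact: uniq_steps.
  + by move=> x /HN [].
  + by move=> x y u v; rewrite !mem_steps => sx sy _ _ [] /(step_seq_inj sp sx sy).
  + move=> [|t p]; rewrite /hasse_path /=.
      by rewrite (negbTE s1); split=> // -[x [p []]].
    rewrite -andbA; split.
      by case/andP=> /(lessdotP _ s0 sp s1) [x sx ->] tp; exists x, p.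
    case=> x [q [sx tq [-> ->]]]; apply/andP; split; last exact: tq.
    by apply/lessdotP => //; exists x.
Qed.

(** * Partitions as words *)

(** The bound [m <= n] keeps the default value [n] from counting as an element below [m]. *)
Lemma block_min_lt n (A : {set 'I_n}) m : m <= n ->
  (block_min A < m) = [exists q in A, q < m].
Proof.
move=> mn; rewrite /block_min; apply/idP/exists_inP.
  move=> Am; apply/exists_inP; apply: contraLR Am => /exists_inPn H; rewrite -leqNgt.
  elim/big_ind: _ => // [x y|q qA]; first by rewrite leq_min => -> ->.
  by rewrite leqNgt H.
case=> q qA; apply: leq_ltn_trans; have := mem_index_enum q.
elim: (index_enum _) => // p r IH; rewrite inE big_cons => /orP [/eqP <-|/IH H].
  by rewrite qA geq_minl.
by case: ifP => // _; rewrite geq_min H orbT.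
Qed.

Lemma lt_block_max n (A : {set 'I_n}) m :
  (m < block_max A) = [exists p in A, m < p].
Proof.
rewrite /block_max; apply/idP/exists_inP => [mA|[p pA mp]].
  apply/exists_inP; apply: contraLR mA => /exists_inPn H; rewrite -leqNgt.
  by apply/bigmax_leqP => p pA; rewrite leqNgt H.
exact/(leq_trans mp)/leq_bigmax_cond.
Qed.

Definition partition_of_word n l (w : seq nat) : l.-tuple {set 'I_n} :=
  [tuple [set p : 'I_n | nth 0 w p == i] | i < l].

Definition word_of_partition n (pi : seq {set 'I_n}) : seq nat :=
  [seq find (fun A : {set 'I_n} => p \in A) pi | p <- enum 'I_n].

Lemma nth_partition_of_word n l w i : i < l ->
  nth set0 (partition_of_word n l w) i = [set p : 'I_n | nth 0 w p == i].
Proof. by move=> il; rewrite (nth_map (Ordinal il)) ?size_enum_ord ?nth_enum_ord. Qed.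

Lemma occ_card n w i : size w = n -> occ i w = #|[set p : 'I_n | nth 0 w p == i]|.
Proof.
move=> wn; rewrite cardsE cardE size_filter -enumT.
have {1}-> : w = [seq nth 0 w p | p : 'I_n].
  apply: (@eq_from_nth _ 0); first by rewrite size_map size_enum_ord.
  move=> j; rewrite wn => jn.
  by rewrite (nth_map (Ordinal jn)) ?size_enum_ord ?nth_enum_ord.
by rewrite /occ count_map.
Qed.

Lemma sumn_occ l w : all (gtn l) w -> sumn [seq occ i w | i <- iota 0 l] = size w.
Proof.
rewrite sumnE big_map; elim: w => [|x w IH] /= => [_|/andP [xl wl]].
  by rewrite big1.
under eq_bigr do rewrite occ_cons; rewrite big_split IH //=.
rewrite -(big_mkcond (fun i => x == i) (fun=> 1)) sum1_count.
rewrite (eq_count (a2 := pred1 x)) => [|i]; last by rewrite eq_sym.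
by rewrite count_uniq_mem ?iota_uniq // mem_iota xl.
Qed.

Lemma find_count1 (X : Type) (a : pred X) x0 r i : count a r = 1 ->
  i < size r -> a (nth x0 r i) = (find a r == i).
Proof.
elim: r i => //= x r IH i; case ax: (a x) => /= cr; last first.
  by case: i => [|i] ir //=; rewrite eqSS IH.
case: i => [|i] //= ir; apply/negP => ai.
have : has a r by apply/(has_nthP x0); exists i.
by rewrite has_count; lia.
Qed.

Lemma count_partition_of_word n l w (p : 'I_n) : nth 0 w p < l ->
  count (fun A : {set 'I_n} => p \in A) (partition_of_word n l w) = 1.
Proof.
move=> pl; rewrite count_map (eq_count (a2 := pred1 (Ordinal pl))).
  by rewrite count_uniq_mem ?enum_uniq // mem_enum.
by move=> i; rewrite /= inE eq_sym.
Qed.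

Lemma sorted_partition_of_word n l w : size w = n ->
  sorted (fun A B => block_max A > block_min B) (partition_of_word n l w) =
  all (fun i => subseq [:: i.+1; i] w) (iota 0 l.-1).
Proof.
move=> wn; apply/(sortedP set0)/allP => H i; rewrite ?mem_iota ?size_tuple => il.
  have {}il : i.+1 < l by lia.
  move: (H i); rewrite size_tuple !nth_partition_of_word ?(ltnW il) // => /(_ il).
  rewrite lt_block_max => /exists_inP [p]; rewrite inE => /eqP pi.
  rewrite block_min_lt 1?ltnW // => /exists_inP [q]; rewrite inE => /eqP qi qp.
  by apply/subseq2P; exists q, p; rewrite wn.
have /subseq2P [q [p [qp pw qi pi]]] : subseq [:: i.+1; i] w.
  by apply: H; rewrite mem_iota; lia.
rewrite wn in pw; rewrite !nth_partition_of_word ?(ltnW il) // lt_block_max.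
apply/exists_inP; exists (Ordinal pw); first by rewrite inE /= pi.
rewrite block_min_lt 1?ltnW //; apply/exists_inP.
by exists (Ordinal (ltn_trans qp pw)); rewrite ?inE /= ?qi.
Qed.

Lemma ncp_type_partition_of_word n l w : size w = n ->
  ncp_type (partition_of_word n l w) = [seq occ i w | i <- iota 0 l].
Proof.
move=> wn; apply: (@eq_from_nth _ 0);
  rewrite size_map size_tuple ?size_map ?size_iota // => i il.
rewrite (nth_map set0) ?size_tuple // nth_partition_of_word //.
by rewrite (nth_map 0) ?size_iota // nth_iota // (occ_card _ wn).
Qed.

(** A word assigns exactly one block to each element, and blocks of the prescribed positive sizes
    are nonempty; what remains to compare is the type and the crossing condition. *)
Lemma is_ncp_partition_of_word s n w : all (fun k => 0 < k) s ->
  size w = n -> all (gtn (size s)) w ->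
  let pi := partition_of_word n (size s) w in
  is_ncp pi && (ncp_type pi == s) = crossing_word s w.
Proof.
move=> sp wn wl pi.
rewrite /crossing_word -(ncp_type_partition_of_word _ wn) wl andbC.
case: eqP => //= E; rewrite /is_ncp sorted_partition_of_word //.
have -> : set0 \notin pi.
  apply/negP => /(map_f (fun A : {set 'I_n} => #|A|)).
  by rewrite cards0 -/(ncp_type _) E => /(allP sp).
suff -> : [forall p, count (fun A : {set 'I_n} => p \in A) pi == 1] by [].
apply/forallP => p; apply/eqP/count_partition_of_word.
by apply: (allP wl); rewrite mem_nth ?wn.
Qed.

Lemma nth_word_of_partition n (pi : seq {set 'I_n}) (p : 'I_n) :
  nth 0 (word_of_partition pi) p = find (fun A : {set 'I_n} => p \in A) pi.
Proof. by rewrite (nth_map p) ?size_enum_ord // nth_ord_enum. Qed.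

Lemma word_of_partition_lt n l (pi : l.-tuple {set 'I_n}) :
  (forall p : 'I_n, count (fun A : {set 'I_n} => p \in A) pi = 1) ->
  all (gtn l) (word_of_partition pi).
Proof.
move=> count_pi; apply/allP => _ /mapP [p _ ->] /=.
by rewrite -[X in _ < X](size_tuple pi) -has_find has_count count_pi.
Qed.

Lemma word_of_partitionK n l (pi : l.-tuple {set 'I_n}) :
  (forall p : 'I_n, count (fun A : {set 'I_n} => p \in A) pi = 1) ->
  partition_of_word n l (word_of_partition pi) = pi.
Proof.
move=> count_pi; apply/val_inj/(@eq_from_nth _ set0); rewrite !size_tuple // => i il.
rewrite nth_partition_of_word //; apply/setP => p.
by rewrite inE nth_word_of_partition -(find_count1 set0) ?size_tuple.
Qed.

Lemma size_word_of_partition n (pi : seq {set 'I_n}) :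
  size (word_of_partition pi) = n.
Proof. by rewrite size_map size_enum_ord. Qed.

Lemma partition_of_wordK n l w : size w = n -> all (gtn l) w ->
  word_of_partition (partition_of_word n l w) = w.
Proof.
move=> wn wl; apply: (@eq_from_nth _ 0); rewrite size_word_of_partition // => i il.
have wi : nth 0 w i < l by apply: (allP wl); rewrite mem_nth ?wn.
rewrite -[i]/(nat_of_ord (Ordinal il)) nth_word_of_partition; apply/eqP.
rewrite -(find_count1 set0) ?size_tuple ?count_partition_of_word //.
by rewrite nth_partition_of_word // inE.
Qed.

Lemma has_card_crossing_word s : all (fun k => 0 < k) s ->
  has_card (crossing_word s) (T s).
Proof.
move=> sp; set D := [set pi : (size s).-tuple {set 'I_(sumn s)} |
  is_ncp pi && (ncp_type pi == s)].
have D1 pi : pi \in D -> forall p, count (fun A : {set _} => p \in A) pi = 1.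
  by rewrite inE => /andP [/and3P [_ /forallP H _] _] p; apply/eqP.
exists [seq word_of_partition (val pi) | pi <- enum D]; split.
- rewrite map_inj_in_uniq ?enum_uniq // => pi1 pi2.
  rewrite !mem_enum => /D1 K1 /D1 K2 E.
  by rewrite -(word_of_partitionK K1) E word_of_partitionK.
- move=> w; apply/mapP/idP => [[pi]|cw].
    rewrite mem_enum => piD -> ; have c1 := D1 _ piD; move: piD.
    rewrite inE -(is_ncp_partition_of_word sp (size_word_of_partition pi)).
      by rewrite word_of_partitionK.
    exact: word_of_partition_lt.
  have /and3P [/eqP wc wl _] := cw.
  (* Summing the letter counts gives the length of the word, hence the right ground set. *)
  have wn : size w = sumn s by rewrite -[in RHS]wc sumn_occ.
  exists (partition_of_word (sumn s) (size s) w).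
    by rewrite mem_enum inE is_ncp_partition_of_word.
  by rewrite partition_of_wordK.
- by rewrite size_map -cardE.
Qed.

Theorem proposition2p14 (s : seq nat) :
  s != [::] -> all (fun k => 0 < k) s -> has_card (hasse_path s) (T s).
Proof.
by move=> s0 sp; apply: has_card_hasse_path => //; exact: has_card_crossing_word.
Qed.
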